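(* Let $\mathcal T$ be a compactly generated triangulated category and let $\mathcal C=\mathcal T^c$ be its full subcategory of compact objects. Let $\mathcal D\subseteq\mathcal T$ be a full triangulated subcategory that contains all compact objects of $\mathcal T$ and all of whose objects are pure-injective in $\mathcal T$. Then the inclusion $\mathcal C\to\mathcal D$ is a partial completion.
   Context: Let $\mathcal T$ be a triangulated category with arbitrary coproducts. An object $X$ is compact if $\operatorname{Hom}(X,-)$ preserves all coproducts; $\mathcal T^c$ denotes the full (thick) subcategory of compact objects. $\mathcal T$ is compactly generated if $\mathcal T^c$ is essentially small and $\mathcal T$ has no proper localising subcategory (full triangulated subcategory closed under coproducts) containing $\mathcal T^c$. For an essentially small triangulated category $\mathcal C$, $\operatorname{Coh}\mathcal C$ denotes the category of cohomological functors $\mathcal C^{\mathrm{op}}\to\mathrm{Ab}$ (additive functors sending exact triangles to exact sequences), with natural transformations as morphisms. An exact functor $f\colon\mathcal C\to\mathcal D$ to a triangulated category $\mathcal D$ induces the restriction functor $f_*\colon\mathcal D\to\operatorname{Coh}\mathcal C$, $X\mapsto\operatorname{Hom}_{\mathcal D}(f(-),X)$. The functor $f$ is called a partial completion of $\mathcal C$ if $f$ is exact and fully faithful and $f_*$ is fully faithful. With $\mathcal C=\mathcal T^c$ and $h_X:=\operatorname{Hom}(-,X)|_{\mathcal C}$ for $X\in\mathcal T$, an exact triangle $X\to Y\to Z\to\Sigma X$ in $\mathcal T$ is pure-exact if $0\to h_X\to h_Y\to h_Z\to 0$ is exact. An object $X\in\mathcal T$ is pure-injective if for each pure-exact triangle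 $X\to Y\to Z\to\Sigma X$ the morphism $X\to Y$ is a split monomorphism. *)

(* Defs.v *)
From HB Require Import structures.
From mathcomp Require Import all_boot all_order all_algebra.
From mathcomp.classical Require Import boolp.

Set Implicit Arguments.
Unset Strict Implicit.
Unset Printing Implicit Defensive.

Import GRing.Theory.
Local Open Scope ring_scope.

Declare Scope cat_scope.
Delimit Scope cat_scope with cat.
Local Open Scope cat_scope.

Record category := Category {
  obj :> Type;
  hom : obj -> obj -> Type;
  idm : forall X, hom X X;
  comp : forall X Y Z, hom Y Z -> hom X Y -> hom X Z;
  comp_idl : forall X Y (f : hom X Y), comp (idm Y) f = f;
  comp_idr : forall X Y (f : hom X Y), comp f (idm X) = f;
  compA : forall W X Y Z (h : hom Y Z) (g : hom X Y) (f : hom W X),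
    comp h (comp g f) = comp (comp h g) f }.

Arguments hom {c} X Y.
Arguments idm {c} X.
Arguments comp {c X Y Z} g f.

Notation "g ∘ f" := (comp g f) (at level 40, left associativity) : cat_scope.

Definition is_iso (C : category) (X Y : C) (f : hom X Y) : Prop :=
  exists g : hom Y X, g ∘ f = idm X /\ f ∘ g = idm Y.

Definition split_mono (C : category) (X Y : C) (f : hom X Y) : Prop :=
  exists r : hom Y X, r ∘ f = idm X.

Definition op (C : category) : category :=
  @Category C (fun X Y => hom Y X) (fun X => idm X)
    (fun X Y Z g f => f ∘ g)
    (fun X Y f => comp_idr f) (fun X Y f => comp_idl f)
    (fun W X Y Z h g f => esym (compA f g h)).

Record functor (C D : category) := Functor {
  fobj :> C -> D;
  fmap : forall X Y, hom X Y -> hom (fobj X) (fobj Y);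
  fmap_id : forall X, fmap (idm X) = idm (fobj X);
  fmap_comp : forall X Y Z (g : hom Y Z) (f : hom X Y),
    fmap (g ∘ f) = fmap g ∘ fmap f }.

Arguments fmap {C D} _ {X Y} _.

Definition full (C D : category) (F : functor C D) : Prop :=
  forall (X Y : C) (g : hom (F X) (F Y)), exists f : hom X Y, fmap F f = g.

Definition faithful (C D : category) (F : functor C D) : Prop :=
  forall (X Y : C) (f g : hom X Y), fmap F f = fmap F g -> f = g.

Definition fully_faithful (C D : category) (F : functor C D) : Prop :=
  full F /\ faithful F.

Definition essentially_surjective (C D : category) (F : functor C D) : Prop :=
  forall Y : D, exists (X : C) (f : hom (F X) Y), is_iso f.

Definition is_equivalence (C D : category) (F : functor C D) : Prop :=
  fully_faithful F /\ essentially_surjective F.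

Record nat_trans (C D : category) (F G : functor C D) := NatTrans {
  nt :> forall X : C, hom (F X) (G X);
  nt_natural : forall (X Y : C) (f : hom X Y), nt Y ∘ fmap F f = fmap G f ∘ nt X }.

Lemma nat_trans_ext (C D : category) (F G : functor C D) (s t : nat_trans F G) :
  (forall X, s X = t X) -> s = t.
Proof.
case: s t => [s sN] [t tN] /= e.
have e' : s = t by apply: functional_extensionality_dep.
by subst t; congr NatTrans; apply: Prop_irrelevance.
Qed.

(* Sizes: morphism groups are of type [zmodType], and [small_set] is the universe
   of the sets that index coproducts.  [carrier] is never used; its type forces
   that universe to contain the carriers of all morphism groups.  Objects live in
   another universe, so a triangulated category may be large. *)

Definition small_set := Type.
Definition carrier (A : zmodType) : small_set := A.

Definition is_coproduct (C : category) (I : small_set) (X : I -> C) (P : C)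
    (inj : forall i, hom (X i) P) : Prop :=
  forall (Z : C) (f : forall i, hom (X i) Z),
    exists! g : hom P Z, forall i, g ∘ inj i = f i.

Definition has_coproducts (C : category) : Prop :=
  forall (I : small_set) (X : I -> C),
    exists (P : C) (inj : forall i, hom (X i) P), is_coproduct inj.

Definition preserves_coproducts (C D : category) (F : functor C D) : Prop :=
  forall (I : small_set) (X : I -> C) (P : C) (inj : forall i, hom (X i) P),
    is_coproduct inj -> is_coproduct (fun i => fmap F (inj i)).

Definition essentially_small (C : category) : Prop :=
  exists (I : small_set) (c : I -> C),
    forall X : C, exists (i : I) (f : hom (c i) X), is_iso f.

Lemma additive_ext (A B : zmodType) (f g : {additive A -> B}) : f =1 g -> f = g.
Proof.
case: f g => [f [[fP]]] [g [[gP]]] /= /funext e; subst g.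
by rewrite (Prop_irrelevance fP gP).
Qed.

Definition Ab : category.
Proof.
refine (@Category zmodType (fun A B => {additive A -> B})
  (fun A => idfun : {additive A -> A})
  (fun A B C g f => (g \o f : {additive A -> C})) _ _ _).
- by move=> A B f; apply: additive_ext.
- by move=> A B f; apply: additive_ext.
- by move=> A B C D h g f; apply: additive_ext.
Defined.

Definition exact_at (A B C : zmodType) (f : {additive A -> B})
    (g : {additive B -> C}) : Prop :=
  forall y : B, g y = 0 <-> exists x : A, f x = y.

Definition short_exact (A B C : zmodType) (f : {additive A -> B})
    (g : {additive B -> C}) : Prop :=
  [/\ injective f, exact_at f g & forall z : C, exists y : B, g y = z].

Record preadditive_category := PreadditiveCategory {
  pre_obj : Type;
  pre_hom : pre_obj -> pre_obj -> zmodType;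
  pre_id : forall X, pre_hom X X;
  pre_comp : forall X Y Z, pre_hom Y Z -> pre_hom X Y -> pre_hom X Z;
  pre_comp_idl : forall X Y (f : pre_hom X Y), pre_comp (pre_id Y) f = f;
  pre_comp_idr : forall X Y (f : pre_hom X Y), pre_comp f (pre_id X) = f;
  pre_compA : forall W X Y Z (h : pre_hom Y Z) (g : pre_hom X Y) (f : pre_hom W X),
    pre_comp h (pre_comp g f) = pre_comp (pre_comp h g) f;
  pre_compDl : forall X Y Z (g g' : pre_hom Y Z) (f : pre_hom X Y),
    pre_comp (g + g') f = pre_comp g f + pre_comp g' f;
  pre_compDr : forall X Y Z (g : pre_hom Y Z) (f f' : pre_hom X Y),
    pre_comp g (f + f') = pre_comp g f + pre_comp g f' }.

Definition preadditive_cat (A : preadditive_category) : category :=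
  Category (@pre_comp_idl A) (@pre_comp_idr A) (@pre_compA A).
Coercion preadditive_cat : preadditive_category >-> category.

Section PreadditiveTheory.
Variable A : preadditive_category.
Implicit Types W X Y Z : A.

Lemma compDl X Y Z (g g' : hom Y Z) (f : hom X Y) :
  (g + g' : hom Y Z) ∘ f = g ∘ f + g' ∘ f.
Proof. exact: pre_compDl. Qed.

Lemma compDr X Y Z (g : hom Y Z) (f f' : hom X Y) :
  g ∘ (f + f' : hom X Y) = g ∘ f + g ∘ f'.
Proof. exact: pre_compDr. Qed.

Lemma comp0r X Y Z (g : hom Y Z) : g ∘ (0 : hom X Y) = 0.
Proof. by apply: (addrI (g ∘ 0)); rewrite -compDr !addr0. Qed.

Lemma comp0l X Y Z (f : hom X Y) : (0 : hom Y Z) ∘ f = 0.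
Proof. by apply: (addrI ((0 : hom Y Z) ∘ f)); rewrite -compDl !addr0. Qed.

Lemma compNr X Y Z (g : hom Y Z) (f : hom X Y) : g ∘ (- f : hom X Y) = - (g ∘ f).
Proof. by apply: (addrI (g ∘ f)); rewrite -compDr !subrr comp0r. Qed.

Lemma compNl X Y Z (g : hom Y Z) (f : hom X Y) : (- g : hom Y Z) ∘ f = - (g ∘ f).
Proof. by apply: (addrI (g ∘ f)); rewrite -compDl !subrr comp0l. Qed.

Lemma compBr X Y Z (g : hom Y Z) (f f' : hom X Y) :
  g ∘ (f - f' : hom X Y) = g ∘ f - g ∘ f'.
Proof. by rewrite compDr compNr. Qed.

Lemma compBl X Y Z (g g' : hom Y Z) (f : hom X Y) :
  (g - g' : hom Y Z) ∘ f = g ∘ f - g' ∘ f.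
Proof. by rewrite compDl compNl. Qed.

Definition postcomp X Y Z (g : hom Y Z) : pre_hom X Y -> pre_hom X Z :=
  fun f => g ∘ (f : hom X Y).
HB.instance Definition _ X Y Z (g : hom Y Z) :=
  GRing.isZmodMorphism.Build (pre_hom X Y) (pre_hom X Z) (postcomp g)
    (fun f f' => compBr g f f').

Definition precomp X Y Z (f : hom X Y) : pre_hom Y Z -> pre_hom X Z :=
  fun g => (g : hom Y Z) ∘ f.
HB.instance Definition _ X Y Z (f : hom X Y) :=
  GRing.isZmodMorphism.Build (pre_hom Y Z) (pre_hom X Z) (precomp f)
    (fun g g' => compBl g g' f).

Definition hom_from X : functor A Ab.
Proof.
refine (@Functor A Ab (fun Y => pre_hom X Y)
  (fun Y Z g => (postcomp g : {additive pre_hom X Y -> pre_hom X Z})) _ _).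
- by move=> Y; apply: additive_ext => f; apply: (@comp_idl A).
- by move=> Y Z Z' g f; apply: additive_ext => h; apply/esym/(@compA A).
Defined.

Definition hom_to X : functor (op A) Ab.
Proof.
refine (@Functor (op A) Ab (fun Y => pre_hom Y X)
  (fun Y Z f => (precomp f : {additive pre_hom Y X -> pre_hom Z X})) _ _).
- by move=> Y; apply: additive_ext => f; apply: (@comp_idr A).
- by move=> Y Z Z' g f; apply: additive_ext => h; apply: (@compA A).
Defined.

Definition is_zero_object Z : Prop :=
  forall X, (forall f : hom X Z, f = 0) /\ (forall f : hom Z X, f = 0).

Definition is_biproduct X Y B (i : hom X B) (j : hom Y B) (p : hom B X)
    (q : hom B Y) : Prop :=
  [/\ p ∘ i = idm X, q ∘ j = idm Y, p ∘ j = 0, q ∘ i = 0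
    & i ∘ p + j ∘ q = idm B].

End PreadditiveTheory.

Record additive_category := AdditiveCategory {
  add_pre :> preadditive_category;
  add_zero : exists Z : add_pre, is_zero_object Z;
  add_biproduct : forall X Y : add_pre,
    exists (B : add_pre) (i : hom X B) (j : hom Y B) (p : hom B X) (q : hom B Y),
      is_biproduct i j p q }.

Definition is_additive (A B : preadditive_category) (F : functor A B) : Prop :=
  forall (X Y : A) (f g : hom X Y), fmap F (f + g) = fmap F f + fmap F g.

Record triangulated_category := TriangulatedCategory {
  tri_add :> additive_category;
  shift : functor tri_add tri_add;
  shift_additive : is_additive shift;
  shift_equivalence : is_equivalence shift;
  exact_triangle : forall X Y Z : tri_add,
    hom X Y -> hom Y Z -> hom Z (shift X) -> Prop;
  tr1_iso : forall (X Y Z X' Y' Z' : tri_add)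
    (u : hom X Y) (v : hom Y Z) (w : hom Z (shift X))
    (u' : hom X' Y') (v' : hom Y' Z') (w' : hom Z' (shift X'))
    (f : hom X X') (g : hom Y Y') (h : hom Z Z'),
    is_iso f -> is_iso g -> is_iso h ->
    g ∘ u = u' ∘ f -> h ∘ v = v' ∘ g -> fmap shift f ∘ w = w' ∘ h ->
    exact_triangle u v w -> exact_triangle u' v' w';
  tr1_id : forall X Z : tri_add, is_zero_object Z ->
    exact_triangle (idm X) (0 : hom X Z) (0 : hom Z (shift X));
  tr1_cone : forall (X Y : tri_add) (u : hom X Y),
    exists (Z : tri_add) (v : hom Y Z) (w : hom Z (shift X)), exact_triangle u v w;
  tr2 : forall (X Y Z : tri_add) (u : hom X Y) (v : hom Y Z) (w : hom Z (shift X)),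
    exact_triangle u v w <-> exact_triangle v w (- fmap shift u);
  tr3 : forall (X Y Z X' Y' Z' : tri_add)
    (u : hom X Y) (v : hom Y Z) (w : hom Z (shift X))
    (u' : hom X' Y') (v' : hom Y' Z') (w' : hom Z' (shift X'))
    (f : hom X X') (g : hom Y Y'),
    exact_triangle u v w -> exact_triangle u' v' w' -> g ∘ u = u' ∘ f ->
    exists h : hom Z Z', h ∘ v = v' ∘ g /\ fmap shift f ∘ w = w' ∘ h;
  tr4 : forall (X Y Z X' Y' Z' : tri_add) (u : hom X Y) (v : hom Y Z)
    (a : hom Y Z') (b : hom Z' (shift X))
    (c : hom Z X') (d : hom X' (shift Y))
    (e : hom Z Y') (k : hom Y' (shift X)),
    exact_triangle u a b -> exact_triangle v c d -> exact_triangle (v ∘ u) e k ->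
    exists (f : hom Z' Y') (g : hom Y' X'),
      [/\ f ∘ a = e ∘ v, k ∘ f = b, g ∘ e = c, d ∘ g = fmap shift u ∘ k
        & exact_triangle f g (fmap shift a ∘ d)] }.

Arguments shift {t}.

(* As usual an exact functor carries its isomorphism with the shifts. *)
Record exact_functor (C D : triangulated_category) := ExactFunctor {
  ex_fun :> functor C D;
  ex_additive : is_additive ex_fun;
  ex_shift : forall X : C, hom (ex_fun (shift X)) (shift (ex_fun X));
  ex_shift_iso : forall X, is_iso (ex_shift X);
  ex_shift_natural : forall (X Y : C) (f : hom X Y),
    ex_shift Y ∘ fmap ex_fun (fmap shift f) = fmap shift (fmap ex_fun f) ∘ ex_shift X;
  ex_exact : forall (X Y Z : C) (u : hom X Y) (v : hom Y Z) (w : hom Z (shift X)),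
    exact_triangle u v w ->
    exact_triangle (fmap ex_fun u) (fmap ex_fun v) (ex_shift X ∘ fmap ex_fun w) }.

(* A morphism of [op C] from [Y] to [X] is a morphism of [C] from [X] to [Y]; the
   type annotations select the category in which it is read. *)
Record cohomological_functor (C : triangulated_category) := CohomologicalFunctor {
  coh_fun :> functor (op C) Ab;
  coh_additive : forall (X Y : C) (f g : hom X Y) (x : coh_fun Y),
    fmap coh_fun (f + g : @hom (op C) Y X) x
      = fmap coh_fun (f : @hom (op C) Y X) x + fmap coh_fun (g : @hom (op C) Y X) x;
  coh_exact : forall (X Y Z : C) (u : hom X Y) (v : hom Y Z) (w : hom Z (shift X)),
    exact_triangle u v w ->
    exact_at (fmap coh_fun (w : @hom (op C) (shift X) Z))
             (fmap coh_fun (v : @hom (op C) Z Y)) /\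
    exact_at (fmap coh_fun (v : @hom (op C) Z Y))
             (fmap coh_fun (u : @hom (op C) Y X)) }.

Definition Coh (C : triangulated_category) : category.
Proof.
refine (@Category (cohomological_functor C) (fun F G => nat_trans F G)
  (fun F => @NatTrans _ _ F F (fun X => idm (F X)) _)
  (fun F G H t s => @NatTrans _ _ F H (fun X => t X ∘ s X) _) _ _ _).
- by move=> F G s; apply: nat_trans_ext => X; apply: comp_idl.
- by move=> F G s; apply: nat_trans_ext => X; apply: comp_idr.
- by move=> E F G H u t s; apply: nat_trans_ext => X; apply: compA.
Unshelve.
- by move=> X Y f; rewrite comp_idl comp_idr.
- by move=> X Y f; rewrite -compA nt_natural compA nt_natural compA.
Defined.

Definition op_functor (C D : category) (F : functor C D) : functor (op C) (op D) :=
  @Functor (op C) (op D) (fun X => F X) (fun X Y f => fmap F (f : @hom C Y X))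
    (fun X => fmap_id F X) (fun X Y Z g f => fmap_comp F f g).

Definition comp_functor (B C D : category) (G : functor C D) (F : functor B C) :
  functor B D.
Proof.
refine (@Functor B D (fun X => G (F X)) (fun X Y f => fmap G (fmap F f)) _ _).
- by move=> X; rewrite !fmap_id.
- by move=> X Y Z g f; rewrite !fmap_comp.
Defined.

Section TriangleTheory.
Variable T : triangulated_category.
Implicit Types W X Y Z : T.

Lemma iso_id (C : category) (X : C) : is_iso (idm X).
Proof. by exists (idm X); rewrite comp_idl. Qed.

Lemma additive0 (A B : preadditive_category) (F : functor A B) :
  is_additive F -> forall X Y : A, fmap F (0 : hom X Y) = 0.
Proof.
by move=> aF X Y; apply: (addrI (fmap F (0 : hom X Y))); rewrite -aF !addr0.
Qed.

Lemma additiveN (A B : preadditive_category) (F : functor A B) :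
  is_additive F -> forall (X Y : A) (f : hom X Y), fmap F (- f) = - fmap F f.
Proof.
move=> aF X Y f; apply: (addrI (fmap F f)).
by rewrite -aF !subrr additive0.
Qed.

Lemma zero_object_id Z : idm Z = 0 -> is_zero_object Z.
Proof.
move=> e X; split=> f.
  by rewrite -(comp_idl f) e comp0l.
by rewrite -(comp_idr f) e comp0r.
Qed.

Lemma zero_object_shift Z : is_zero_object Z -> is_zero_object (shift Z).
Proof.
move=> hZ; apply: zero_object_id.
by rewrite -fmap_id (proj1 (hZ Z) (idm Z)) (additive0 (@shift_additive T)).
Qed.

Lemma triangle_comp0 X Y Z (u : hom X Y) (v : hom Y Z) (w : hom Z (shift X)) :
  exact_triangle u v w -> v ∘ u = 0.
Proof.
move=> t; have [O hO] := add_zero T.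
have [|h [<- _]] := tr3 (tr1_id X hO) t (f := idm X) (g := u); first by [].
exact: comp0r.
Qed.

Lemma triangle_lift X Y Z (u : hom X Y) (v : hom Y Z) (w : hom Z (shift X)) :
  exact_triangle u v w -> forall W (f : hom W Y), v ∘ f = 0 ->
  exists g : hom W X, u ∘ g = f.
Proof.
move=> /tr2 t W f vf; have [O hO] := add_zero T.
have /tr2 t0 := tr1_id W hO.
have [|h [_ e]] := tr3 t0 t (f := f) (g := 0); first by rewrite comp0l vf.
have [[fu fa] _] := shift_equivalence T.
have [g hg] := fu _ _ h; exists g; apply: fa.
move: e; rewrite fmap_id compNr compNl comp_idr => /oppr_inj ->.
by rewrite fmap_comp hg.
Qed.

Lemma triangle_extend X Y Z (u : hom X Y) (v : hom Y Z) (w : hom Z (shift X)) :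
  exact_triangle u v w -> forall W (f : hom Y W), f ∘ u = 0 ->
  exists g : hom Z W, g ∘ v = f.
Proof.
move=> t W f fu; have [O hO] := add_zero T.
have t0 : exact_triangle (0 : hom O W) (idm W) (0 : hom W (shift O)).
  apply/tr2; rewrite (additive0 (@shift_additive T)) oppr0.
  exact: tr1_id (zero_object_shift hO).
have [|h [e _]] := tr3 t t0 (f := 0) (g := f); first by rewrite comp0l fu.
by exists h; rewrite e comp_idl.
Qed.

End TriangleTheory.

Section Restriction.
Variables (C D : triangulated_category) (f : exact_functor C D).

Definition restriction_obj (X : D) : cohomological_functor C.
Proof.
refine (@CohomologicalFunctor C (comp_functor (hom_to X) (op_functor f)) _ _).
- move=> Y Z g h x /=; rewrite /precomp ex_additive; exact: compDr.
- move=> Y1 Y2 Y3 u v w /(ex_exact f) t; split=> y /=; rewrite /precomp.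
  + have [i [ij ji]] := ex_shift_iso f Y1; split=> [yv|[x <-]].
      move/tr2: t => t.
      have [x <-] := triangle_extend t yv.
      by exists ((x : hom (shift (f Y1)) X) ∘ ex_shift f Y1); rewrite compA.
    have -> : (x : hom (f (shift Y1)) X) ∘ fmap f w =
        (x : hom (f (shift Y1)) X) ∘ i ∘ (ex_shift f Y1 ∘ fmap f w).
      by rewrite compA -(compA (x : hom (f (shift Y1)) X)) ij comp_idr.
    move/tr2/triangle_comp0: t => t.
    by rewrite -compA t comp0r.
  + split=> [yu|[x <-]]; first by have [x <-] := triangle_extend t yu; exists x.
    by rewrite -compA (triangle_comp0 t) comp0r.
Defined.

Definition restriction : functor D (Coh C).
Proof.
refine (@Functor D (Coh C) restriction_obj
  (fun X X' g => @NatTrans _ _ (restriction_obj X) (restriction_obj X')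
    (fun Y : C =>
      (postcomp g : {additive pre_hom (f Y) X -> pre_hom (f Y) X'})) _) _ _).
- by move=> X; apply: nat_trans_ext => Y; apply: additive_ext => h;
    apply: (@comp_idl D).
- by move=> X X' X'' g' g; apply: nat_trans_ext => Y; apply: additive_ext => h;
    apply/esym/(@compA D).
Unshelve.
by move=> Y Z h; apply: additive_ext => x; apply: (@compA D).
Defined.

End Restriction.

(* The first conjunct is the standing assumption on [C] under which [Coh C] and
   partial completions are considered. *)
Definition is_partial_completion (C D : triangulated_category)
    (f : exact_functor C D) : Prop :=
  [/\ essentially_small C, fully_faithful f & fully_faithful (restriction f)].

Definition full_preadditive (A : preadditive_category) (S : A -> Prop) :
    preadditive_category :=
  @PreadditiveCategory {X : A | S X} (fun X Y => pre_hom (sval X) (sval Y))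
    (fun X => pre_id (sval X)) (fun X Y Z g f => pre_comp g f)
    (fun X Y f => pre_comp_idl f) (fun X Y f => pre_comp_idr f)
    (fun W X Y Z h g f => pre_compA h g f)
    (fun X Y Z g g' f => pre_compDl g g' f)
    (fun X Y Z g f f' => pre_compDr g f f').

(* Membership is invariant under isomorphism, see [sub_iso]. *)
Record triangulated_subcategory (T : triangulated_category) (S : T -> Prop) : Prop :=
  TriangulatedSubcategory {
    sub_zero : forall Z : T, is_zero_object Z -> S Z;
    sub_shift : forall X : T, S X <-> S (shift X);
    sub_triangle3 : forall (X Y Z : T) (u : hom X Y) (v : hom Y Z)
      (w : hom Z (shift X)), exact_triangle u v w -> S X -> S Y -> S Z;
    sub_triangle2 : forall (X Y Z : T) (u : hom X Y) (v : hom Y Z)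
      (w : hom Z (shift X)), exact_triangle u v w -> S X -> S Z -> S Y;
    sub_triangle1 : forall (X Y Z : T) (u : hom X Y) (v : hom Y Z)
      (w : hom Z (shift X)), exact_triangle u v w -> S Y -> S Z -> S X }.

Section FullTriangulated.
Variables (T : triangulated_category) (S : T -> Prop).
Hypothesis hS : triangulated_subcategory S.

Lemma sub_iso (X Y : T) (f : hom X Y) : is_iso f -> S X -> S Y.
Proof.
move=> hf sX; have [O hO] := add_zero T.
apply: (sub_triangle2 hS _ sX (sub_zero hS hO)).
apply: (tr1_iso (iso_id X) hf (iso_id O) _ _ _ (tr1_id X hO) (u' := f)
  (v' := 0) (w' := 0)).
- by [].
- by rewrite comp0l comp0r.
- by rewrite comp0l comp0r.
Qed.

Lemma split_triangle (X Y B : T) (i : hom X B) (j : hom Y B) (p : hom B X)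
    (q : hom B Y) : is_biproduct i j p q -> exact_triangle i q (0 : hom Y (shift X)).
Proof.
case=> pi qj pj qi e; have [Z [v [w t]]] := tr1_cone i.
have w0 : w = 0.
  have t2 := t; move/tr2 in t2; move/tr2/triangle_comp0: t2.
  rewrite compNl => /eqP; rewrite oppr_eq0 => /eqP iw.
  have := congr1 (fun g => fmap shift p ∘ g) iw.
  by rewrite comp0r compA -fmap_comp pi fmap_id comp_idl.
have [s vs] : exists s : hom Z B, v ∘ s = idm Z.
  by move/tr2: (t) => t2; apply: (triangle_lift t2); rewrite w0 comp0l.
have [r rv] := triangle_extend t qi.
have vi := triangle_comp0 t.
have vjr : v ∘ j ∘ r = idm Z.
  rewrite -[LHS]comp_idr -vs compA -(compA (v ∘ j)) rv -(compA v).
  have -> : j ∘ q = (idm B - i ∘ p : hom B B) by rewrite -e addrAC subrr add0r.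
  by rewrite compBr comp_idr compA vi comp0l subr0.
have isor : is_iso r by exists (v ∘ j); rewrite vjr compA rv qj.
apply: (tr1_iso (iso_id X) (iso_id B) isor _ _ _ t).
- by rewrite comp_idl comp_idr.
- by rewrite rv comp_idr.
- by rewrite w0 comp0r comp0l.
Qed.

Definition full_additive : additive_category.
Proof.
apply: (@AdditiveCategory (full_preadditive S)).
- have [O hO] := add_zero T; exists (exist _ O (sub_zero hS hO)).
  by move=> X; have [h1 h2] := hO (sval X); split=> f; [apply: h1|apply: h2].
- move=> [X sX] [Y sY]; have [B [i [j [p [q b]]]]] := add_biproduct X Y.
  exists (exist _ B (sub_triangle2 hS (split_triangle b) sX sY)).
  by exists i, j, p, q; case: b.
Defined.

Definition full_shift : functor full_additive full_additive :=
  @Functor full_additive full_additive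
    (fun X => exist _ (shift (sval X)) (proj1 (sub_shift hS (sval X)) (svalP X)))
    (fun X Y f => fmap shift (f : hom (sval X) (sval Y)))
    (fun X => fmap_id shift (sval X))
    (fun X Y Z g f => fmap_comp shift (g : hom (sval Y) (sval Z))
       (f : hom (sval X) (sval Y))).

Lemma full_iso (X Y : full_additive) (f : hom (sval X) (sval Y)) :
  is_iso f <-> is_iso (f : hom X Y).
Proof. by split; case=> g h; exists g. Qed.

Definition full_triangulated : triangulated_category.
Proof.
apply: (@TriangulatedCategory full_additive full_shift _ _
  (fun X Y Z u v w => @exact_triangle T (sval X) (sval Y) (sval Z) u v w)).
- by move=> X Y f g; apply: (@shift_additive T).
- have [[fu fa] es] := shift_equivalence T; split; [split|].
  + by move=> X Y g; apply: fu.
  + by move=> X Y f g; apply: fa.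
  + move=> [Y sY]; have [X [f hf]] := es Y.
    have sX : S X.
      apply/(sub_shift hS); have [g [gf fg]] := hf.
      by apply: (@sub_iso Y _ g) => //; exists f.
    by exists (exist _ X sX), f; apply/full_iso.
- move=> X Y Z X' Y' Z' u v w u' v' w' f g h /full_iso hf /full_iso hg /full_iso hh.
  exact: tr1_iso.
- move=> X Z hZ; apply: tr1_id; apply: zero_object_id.
  exact: (proj1 (hZ Z) (idm Z)).
- move=> [X sX] [Y sY] u; have [Z [v [w t]]] := tr1_cone (u : hom X Y).
  by exists (exist _ Z (sub_triangle3 hS t sX sY)), v, w.
- by move=> X Y Z u v w; apply: tr2.
- by move=> X Y Z X' Y' Z' u v w u' v' w' f g; apply: tr3.
- by move=> X Y Z X' Y' Z' u v a b c d e k; apply: tr4.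
Defined.

End FullTriangulated.

Definition inclusion (T : triangulated_category) (S S' : T -> Prop)
    (hS : triangulated_subcategory S) (hS' : triangulated_subcategory S')
    (le : forall X, S X -> S' X) :
  exact_functor (full_triangulated hS) (full_triangulated hS').
Proof.
pose F := @Functor (full_triangulated hS) (full_triangulated hS')
  (fun X => exist _ (sval X) (le (sval X) (svalP X))) (fun X Y f => f)
  (fun X => erefl) (fun X Y Z g f => erefl).
apply: (@ExactFunctor _ _ F _ (fun X => @idm T (shift (sval X)))).
- by [].
- by move=> X; exists (@idm T (shift (sval X))); split; apply: (@comp_idl T).
- by move=> X Y f; rewrite [LHS](@comp_idl T) [RHS](@comp_idr T).
- move=> X Y Z u v w t; rewrite /exact_triangle /=.
  by rewrite [X in @exact_triangle T _ _ _ _ _ X](@comp_idl T).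
Defined.

Definition full_inclusion (T : triangulated_category) (S : T -> Prop)
    (hS : triangulated_subcategory S) : exact_functor (full_triangulated hS) T.
Proof.
pose F := @Functor (full_triangulated hS) T (fun X => sval X) (fun X Y f => f)
  (fun X => erefl) (fun X Y Z g f => erefl).
apply: (@ExactFunctor _ _ F _ (fun X => @idm T (shift (sval X)))).
- by [].
- by move=> X; apply: iso_id.
- by move=> X Y f; rewrite [LHS](@comp_idl T) [RHS](@comp_idr T).
- move=> X Y Z u v w t /=.
  by rewrite [X in exact_triangle _ _ X](@comp_idl T).
Defined.

Section AbCoproduct.
Variables (I : small_set) (X : I -> zmodType) (P : zmodType).
Variable inj : forall i, {additive X i -> P}.

Definition supported (s : seq {classic I}) (a : forall i, X i) : Prop :=
  uniq s /\ forall i : {classic I}, i \notin s -> a i = 0.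

Definition combination (s : seq {classic I}) (a : forall i, X i) : P :=
  \sum_(i <- s) inj i (a i).

Lemma combination_subset (Z : zmodType) (g : forall i, X i -> Z)
    (s t : seq {classic I}) (a : forall i, X i) :
  (forall i, g i 0 = 0) -> supported s a -> uniq t -> {subset s <= t} ->
  \sum_(i <- t) g i (a i) = \sum_(i <- s) g i (a i).
Proof.
move=> g0 [us s0] ut st.
have e : perm_eq s [seq i <- t | i \in s].
  apply: uniq_perm => //; first exact: filter_uniq.
  by move=> i; rewrite mem_filter andb_idr //; apply: st.
rewrite (perm_big _ e) /= big_filter [RHS]big_mkcond /=.
by apply: eq_bigr => i _; case: ifPn => // /s0 ->.
Qed.

Lemma supported_widen (s t : seq {classic I}) a :
  supported s a -> uniq t -> {subset s <= t} -> supported t a.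
Proof.
by move=> [us s0] ut st; split=> // i it; apply: s0; apply: contra it; apply: st.
Qed.

Lemma combinationB (s t : seq {classic I}) a b : supported s a -> supported t b ->
  exists r, [/\ supported r a, supported r b, supported r (fun i => a i - b i),
    combination r (fun i => a i - b i) = combination s a - combination t b
    & forall (Z : zmodType) (g : forall i, {additive X i -> Z}),
      \sum_(i <- r) g i (a i) = \sum_(i <- s) g i (a i) /\
      \sum_(i <- r) g i (b i) = \sum_(i <- t) g i (b i)].
Proof.
move=> hs ht; pose r := undup (s ++ t).
have ur : uniq r by apply: undup_uniq.
have sr : {subset s <= r} by move=> i; rewrite mem_undup mem_cat => ->.
have tr : {subset t <= r} by move=> i; rewrite mem_undup mem_cat orbC => ->.
have E (Z : zmodType) (g : forall i, {additive X i -> Z}) :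
    \sum_(i <- r) g i (a i) = \sum_(i <- s) g i (a i) /\
    \sum_(i <- r) g i (b i) = \sum_(i <- t) g i (b i).
  by split; apply: (combination_subset (g := fun i => g i)) => // i; rewrite raddf0.
exists r; have ra := supported_widen hs ur sr; have rb := supported_widen ht ur tr.
split=> //.
  by split=> // i ir; rewrite (proj2 ra) // (proj2 rb) // subr0.
rewrite /combination; have [<- <-] := E _ inj.
by rewrite -sumrB; apply: eq_bigr => i _; rewrite raddfB.
Qed.

Definition generating : Prop :=
  forall x : P, exists s a, supported s a /\ x = combination s a.

Definition independent : Prop :=
  forall s a, supported s a -> combination s a = 0 -> forall i, a i = 0.

Definition single (i : I) (x : X i) (j : I) : X j :=
  if pselect (i = j) is left e then ecast k (X k) e x else 0.

Lemma single_eq i x : single x i = x :> X i.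
Proof.
rewrite /single; case: pselect => // e.
by rewrite (Prop_irrelevance e (erefl i)).
Qed.

Lemma single_neq i (x : X i) j : i <> j -> single x j = 0.
Proof. by rewrite /single; case: pselect. Qed.

Lemma single_additive i j : zmod_morphism (fun x : X i => single x j).
Proof.
move=> x y; rewrite /single; case: pselect => [e|_]; last by rewrite subrr.
by subst j.
Qed.

Lemma supported_single i (x : X i) : supported [:: i : {classic I}] (single x).
Proof.
by split=> // j; rewrite inE => /eqP ij; apply: single_neq => /esym.
Qed.

Lemma combination_single i (x : X i) :
  combination [:: i : {classic I}] (single x) = inj i x.
Proof. by rewrite /combination big_seq1 single_eq. Qed.

Definition in_span : {pred P} := fun x =>
  `[< exists s a, supported s a /\ x = combination s a >].

Lemma in_span_closed : zmod_closed in_span.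
Proof.
split.
  apply/asboolP; exists [::], (fun=> 0).
  by split; [split|rewrite /combination big_nil].
move=> x y /asboolP [s [a [sa ->]]] /asboolP [t [b [tb ->]]].
have [r [_ _ rab e _]] := combinationB sa tb.
by apply/asboolP; exists r, (fun i => a i - b i).
Qed.

HB.instance Definition _ := GRing.isZmodClosed.Build P in_span in_span_closed.

Record span := Span { span_val : P; _ : span_val \in in_span }.
HB.instance Definition _ := [isSub for span_val].
HB.instance Definition _ := [Choice of span by <:].
HB.instance Definition _ := [SubChoice_isSubZmodule of span by <:].

Lemma coproduct_generating : @is_coproduct Ab I X P inj -> generating.
Proof.
move=> hP.
have inj_span i (x : X i) : inj i x \in in_span.
  apply/asboolP; exists [:: i : {classic I}], (single x).
  by split; [apply: supported_single|rewrite combination_single].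
pose f i (x : X i) : span := Span (inj_span i x).
have fa i : zmod_morphism (f i).
  by move=> x y; apply: val_inj; rewrite /= raddfB.
pose F i : {additive X i -> span} :=
  HB.pack (f i) (GRing.isZmodMorphism.Build _ _ (f i) (fa i)).
have [g [gF _]] := hP span F.
have [h [_ hu]] := hP P inj.
have e1 : h = idfun :> {additive P -> P}.
  by apply: hu => i; apply: additive_ext.
have e2 : h = (val : {additive span -> P}) \o g :> {additive P -> P}.
  apply: hu => i; apply: additive_ext => x /=.
  have := congr1 (fun k : {additive X i -> span} => k x) (gF i).
  by rewrite /= => ->.
move=> x; have := valP (g x : span).
have -> : val (g x : span) = x.
  have := congr1 (fun k : {additive P -> P} => k x) (etrans (esym e2) e1).
  by [].
by move/asboolP.
Qed.

Lemma coproduct_independent : @is_coproduct Ab I X P inj -> independent.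
Proof.
move=> hP s a sa e i.
pose F j : {additive X j -> X i} := HB.pack (fun x : X j => single x i)
  (GRing.isZmodMorphism.Build _ _ (fun x : X j => single x i) (@single_additive j i)).
have [g [gF _]] := hP (X i) F.
have gE j (x : X j) : (g : {additive P -> X i}) (inj j x) = single x i.
  exact: (congr1 (fun k : {additive X j -> X i} => k x) (gF j)).
have [is_|] := boolP ((i : {classic I}) \in s); last exact: (proj2 sa).
have := congr1 (g : {additive P -> X i}) e.
rewrite raddf0 /combination raddf_sum (bigD1_seq (i : {classic I})) //=; last first.
  exact: (proj1 sa).
rewrite gE single_eq big1 ?addr0 // => j /eqP ji.
by rewrite gE single_neq.
Qed.

Lemma coproduct_intro : generating -> independent -> @is_coproduct Ab I X P inj.
Proof.
move=> gen ind Z f.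
have {gen} [S hS] : exists S : P -> seq {classic I} * (forall i, X i),
    forall x, supported (S x).1 (S x).2 /\ x = combination (S x).1 (S x).2.
  have [|S hS] := @choice P (seq {classic I} * (forall i, X i))%type
      (fun x S => supported S.1 S.2 /\ x = combination S.1 S.2).
    by move=> x; have [s [a h]] := gen x; exists (s, a).
  by exists S.
pose g x : Z := \sum_(i <- (S x).1) f i ((S x).2 i).
have gE s a x : supported s a -> x = combination s a ->
    g x = \sum_(i <- s) (f i : {additive X i -> Z}) (a i).
  move=> sa xE; have [h1 h2] := hS x.
  have [r [_ _ rab e E]] := combinationB h1 sa.
  have ab : forall i, (S x).2 i = a i.
    move=> i; apply/subr0_eq; apply: (ind _ _ rab).
    by rewrite e -h2 -xE subrr.
  rewrite /g; have [<- <-] := E _ f.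
  by apply: eq_bigr => i _; rewrite ab.
have ga : zmod_morphism g.
  move=> x y; have [hx ex] := hS x; have [hy ey] := hS y.
  have [r [_ _ rab e E]] := combinationB hx hy.
  rewrite (gE r _ (x - y) rab); last by rewrite e -ex -ey.
  rewrite /g; have [<- <-] := E _ f.
  by rewrite -sumrB; apply: eq_bigr => i _; rewrite raddfB.
pose G : {additive P -> Z} := HB.pack g (GRing.isZmodMorphism.Build _ _ g ga).
exists G; split=> [i|g' g'f].
  apply: additive_ext => x /=.
  rewrite (gE [:: i : {classic I}] (single x)); first by rewrite big_seq1 single_eq.
    exact: supported_single.
  by rewrite combination_single.
apply: additive_ext => x; have [h1 h2] := hS x.
rewrite [in RHS]h2 /combination raddf_sum /=; apply: eq_bigr => i _.
exact: (congr1 (fun k : {additive X i -> Z} => k ((S x).2 i)) (esym (g'f i))).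
Qed.

End AbCoproduct.

(* Five lemma for coproducts: rows [A1 -> A2 -> A3 -> A4 -> A5] exact at the
   inner terms, for each index and for the candidate coproduct. *)
Section FiveLemma.
Variable I : small_set.
Variables (A1 A2 A3 A4 A5 : I -> zmodType) (P1 P2 P3 P4 P5 : zmodType).
Variables (j1 : forall i, {additive A1 i -> P1}) (j2 : forall i, {additive A2 i -> P2})
  (j3 : forall i, {additive A3 i -> P3}) (j4 : forall i, {additive A4 i -> P4})
  (j5 : forall i, {additive A5 i -> P5}).
Variables (d1 : forall i, {additive A1 i -> A2 i}) (d2 : forall i, {additive A2 i -> A3 i})
  (d3 : forall i, {additive A3 i -> A4 i}) (d4 : forall i, {additive A4 i -> A5 i}).
Variables (D1 : {additive P1 -> P2}) (D2 : {additive P2 -> P3})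
  (D3 : {additive P3 -> P4}) (D4 : {additive P4 -> P5}).
Hypotheses (c1 : forall i x, D1 (j1 i x) = j2 i (d1 i x))
  (c2 : forall i x, D2 (j2 i x) = j3 i (d2 i x))
  (c3 : forall i x, D3 (j3 i x) = j4 i (d3 i x))
  (c4 : forall i x, D4 (j4 i x) = j5 i (d4 i x)).
Hypotheses (e2 : forall i, exact_at (d1 i) (d2 i)) (e3 : forall i, exact_at (d2 i) (d3 i))
  (e4 : forall i, exact_at (d3 i) (d4 i)).
Hypotheses (E2 : exact_at D1 D2) (E3 : exact_at D2 D3) (E4 : exact_at D3 D4).
Hypotheses (h1 : @is_coproduct Ab I A1 P1 j1) (h2 : @is_coproduct Ab I A2 P2 j2)
  (h4 : @is_coproduct Ab I A4 P4 j4) (h5 : @is_coproduct Ab I A5 P5 j5).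

Lemma supported_map (X Y : I -> zmodType) (g : forall i, {additive X i -> Y i})
    (s : seq {classic I}) (a : forall i, X i) :
  supported s a -> supported s (fun i => g i (a i)).
Proof. by move=> [us s0]; split=> // i /s0 ->; rewrite raddf0. Qed.

Lemma combination_map (X Y : I -> zmodType) (P Q : zmodType)
    (j : forall i, {additive X i -> P}) (k : forall i, {additive Y i -> Q})
    (g : forall i, {additive X i -> Y i}) (G : {additive P -> Q})
    (s : seq {classic I}) (a : forall i, X i) :
  (forall i x, G (j i x) = k i (g i x)) ->
  G (combination j s a) = combination k s (fun i => g i (a i)).
Proof.
by move=> c; rewrite /combination raddf_sum; apply: eq_bigr => i _; rewrite c.
Qed.

Lemma supported_lift (X Y : I -> zmodType) (g : forall i, {additive X i -> Y i})
    (s : seq {classic I}) (b : forall i, Y i) :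
  supported s b -> (forall i, exists x, g i x = b i) ->
  exists a, supported s a /\ forall i, g i (a i) = b i.
Proof.
move=> [us s0] h.
exists (fun i => if (i : {classic I}) \in s then projT1 (cid (h i)) else 0).
split; first by split=> // i /negbTE ->.
move=> i; case: ifPn => [_|/s0 ->]; last by rewrite raddf0.
by case: cid.
Qed.

Lemma five_coproduct : @is_coproduct Ab I A3 P3 j3.
Proof.
have I2 := coproduct_independent h2; have I4 := coproduct_independent h4.
have I5 := coproduct_independent h5; have G1 := coproduct_generating h1.
have G2 := coproduct_generating h2; have G4 := coproduct_generating h4.
apply: coproduct_intro => [x|s a sa ea].
  have [s [b [sb eb]]] := G4 (D3 x).
  have b0 i : d4 i (b i) = 0.
    apply: (I5 _ _ (supported_map d4 sb)).
    by rewrite -(combination_map s b c4) -eb; apply/E4; exists x.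
  have [a [sa ab]] := supported_lift sb (fun i => proj1 (e4 (b i)) (b0 i)).
  have [y ey] : exists y, D2 y = x - combination j3 s a.
    apply/E3; rewrite raddfB /= (combination_map s a c3) eb.
    by apply/eqP; rewrite subr_eq0; apply/eqP/eq_bigr => i _; rewrite ab.
  have [t [a' [ta' ea']]] := G2 (- y).
  have [r [_ _ rab er _]] := combinationB j3 sa (supported_map d2 ta').
  exists r, (fun i => a i - d2 i (a' i)); split=> //.
  by rewrite er -(combination_map t a' c2) -ea' raddfN opprK ey addrC subrK.
have a0 i : d3 i (a i) = 0.
  apply: (I4 _ _ (supported_map d3 sa)).
  by rewrite -(combination_map s a c3) ea raddf0.
have [b [sb ab]] := supported_lift sa (fun i => proj1 (e3 (a i)) (a0 i)).
have [y ey] : exists y, D1 y = combination j2 s b.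
  apply/E2; rewrite (combination_map s b c2) -[RHS]ea.
  by apply: eq_bigr => i _; rewrite ab.
have [t [z [tz ez]]] := G1 y.
have [r [_ _ rbz er _]] := combinationB j2 sb (supported_map d1 tz).
move=> i; rewrite -ab; apply/e2; exists (z i); apply/esym/subr0_eq.
apply: (I2 _ _ rbz); rewrite er -(combination_map t z c1) -ez ey.
exact: subrr.
Qed.

End FiveLemma.

Lemma bijective_coproduct (I : small_set) (X Y : I -> zmodType) (P Q : zmodType)
    (j : forall i, {additive X i -> P}) (k : forall i, {additive Y i -> Q})
    (g : forall i, {additive X i -> Y i}) (G : {additive P -> Q}) :
  (forall i x, G (j i x) = k i (g i x)) ->
  (forall i, bijective (g i)) -> bijective G ->
  @is_coproduct Ab I X P j <-> @is_coproduct Ab I Y Q k.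
Proof.
move=> c bg [G' GK G'K].
have gi i := bij_inj (bg i).
have gs i y : exists x, g i x = y by have [g' _ g'K] := bg i; exists (g' y).
split=> h.
  have gen := coproduct_generating h; have ind := coproduct_independent h.
  apply: coproduct_intro => [y|s b sb].
    have [s [a [sa ea]]] := gen (G' y).
    exists s, (fun i => g i (a i)); split; first exact: supported_map.
    by rewrite -(combination_map s a c) -ea G'K.
  have [a [sa ab]] := supported_lift sb (fun i => gs i (b i)) => e i.
  rewrite -ab (ind _ _ sa) ?raddf0 //; apply: (can_inj GK).
  rewrite (combination_map s a c) raddf0 -e.
  by apply: eq_bigr => k' _; rewrite ab.
have gen := coproduct_generating h; have ind := coproduct_independent h.
apply: coproduct_intro => [x|s a sa e i].
  have [s [b [sb eb]]] := gen (G x).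
  have [a [sa ab]] := supported_lift sb (fun i => gs i (b i)).
  exists s, a; split=> //; apply: (can_inj GK).
  by rewrite (combination_map s a c) eb; apply: eq_bigr => i _; rewrite ab.
apply: (gi i); rewrite raddf0; apply: (ind _ _ (supported_map g sa)).
by rewrite -(combination_map s a c) e raddf0.
Qed.

Lemma iso_coproduct (C : category) (I : small_set) (X Y : I -> C) (P Q : C)
    (j : forall i, hom (X i) P) (k : forall i, hom (Y i) Q)
    (g : forall i, hom (X i) (Y i)) (G : hom P Q) :
  (forall i, G ∘ j i = k i ∘ g i) -> (forall i, is_iso (g i)) -> is_iso G ->
  is_coproduct j -> is_coproduct k.
Proof.
move=> c ig [G' [G'G GG']] h Z f.
have [m [mE mU]] := h Z (fun i => f i ∘ g i).
exists (m ∘ G'); split=> [i|m' m'E].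
  have [g' [_ gg']] := ig i.
  rewrite -[LHS]comp_idr -[RHS]comp_idr -gg' compA -(compA _ (k i)) -c.
  by rewrite -(compA m) (compA G') G'G comp_idl mE compA.
rewrite (mU (m' ∘ G)); first by rewrite -compA GG' comp_idr.
by move=> i; rewrite -compA c compA m'E.
Qed.

Lemma equivalence_coproduct (C D : category) (F : functor C D) :
  is_equivalence F -> forall (I : small_set) (X : I -> C) (P : C)
  (j : forall i, hom (X i) P),
  is_coproduct j <-> is_coproduct (fun i => fmap F (j i)).
Proof.
move=> [[fu fa] es] I X P j; split=> h Z f; last first.
  have [m [mE mU]] := h (F Z) (fun i => fmap F (f i)).
  have [g gm] := fu _ _ m; exists g; split=> [i|g' g'E].
    by apply: fa; rewrite fmap_comp gm mE.
  by apply: fa; rewrite gm; apply: mU => i; rewrite -fmap_comp g'E.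
have [W [e [e' [e'e ee']]]] := es Z.
have f' i : {f' : hom (X i) W | fmap F f' = e' ∘ f i} by apply/cid/fu.
have [g [gE gU]] := h W (fun i => sval (f' i)).
exists (e ∘ fmap F g); split=> [i|m mE].
  by rewrite -compA -fmap_comp gE (svalP (f' i)) compA ee' comp_idl.
have [m' m'E] := fu _ _ (e' ∘ m).
rewrite (gU m') ?m'E ?compA ?ee' ?comp_idl // => i.
by apply: fa; rewrite fmap_comp m'E -compA mE (svalP (f' i)).
Qed.

Definition compact (T : triangulated_category) (X : T) : Prop :=
  preserves_coproducts (hom_from X).

Section Compact.
Variable T : triangulated_category.
Implicit Types W X Y Z : T.

Lemma hom_shift_bij X Y : bijective (fun f : hom X Y => fmap shift f).
Proof.
have [[fu fa] _] := shift_equivalence T.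
exists (fun g => projT1 (cid (fu X Y g))) => [f|g]; last by case: cid.
by apply: fa; case: cid.
Qed.

Definition hom_shift X Y : pre_hom X Y -> pre_hom (shift X) (shift Y) :=
  fun f => fmap shift (f : hom X Y).

Lemma hom_shift_additive X Y : zmod_morphism (@hom_shift X Y).
Proof.
move=> f g; rewrite /hom_shift -(additiveN (@shift_additive T)).
exact: (@shift_additive T).
Qed.
HB.instance Definition _ X Y :=
  GRing.isZmodMorphism.Build _ _ (@hom_shift X Y) (@hom_shift_additive X Y).

Lemma hom_shift_coproduct X (I : small_set) (Y : I -> T) (P : T)
    (j : forall i, hom (Y i) P) :
  is_coproduct (fun i => fmap (hom_from X) (j i)) <->
  is_coproduct (fun i => fmap (hom_from (shift X)) (fmap shift (j i))).
Proof.
apply: (bijective_coproduct (g := fun i => @hom_shift X (Y i)) (G := @hom_shift X P)).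
- by move=> i x; apply: (@fmap_comp _ _ (@shift T)).
- by move=> i; apply: hom_shift_bij.
- exact: hom_shift_bij.
Qed.

Lemma fmap_iso (C D : category) (F : functor C D) (X Y : C) (f : hom X Y) :
  is_iso f -> is_iso (fmap F f).
Proof.
by move=> [g [gf fg]]; exists (fmap F g); rewrite -!fmap_comp gf fg !fmap_id.
Qed.

Lemma compact_shift X : compact X <-> compact (shift X).
Proof.
have es := proj2 (shift_equivalence T).
have eqs := equivalence_coproduct (shift_equivalence T).
split=> cX I Y P j hj; last first.
  apply/hom_shift_coproduct; apply: (cX I (fun i => shift (Y i)) (shift P)).
  exact: (proj1 (eqs I Y P j) hj).
have W i : {W : T & {f : hom (shift W) (Y i) | is_iso f}}.
  by have [V /cid h] := cid (es (Y i)); exists V.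
have [Q [e [e' [e'e ee']]]] := es P.
pose f i := sval (projT2 (W i)); have fi i : is_iso (f i) := svalP (projT2 (W i)).
have k i : {k : hom (projT1 (W i)) Q | fmap shift k = e' ∘ (j i ∘ f i)}.
  by apply/cid; have [[fu _] _] := shift_equivalence T; apply: fu.
have ie : is_iso e by exists e'.
have c i : e ∘ fmap shift (sval (k i)) = j i ∘ f i.
  by rewrite (svalP (k i)) compA ee' comp_idl.
have hk : is_coproduct (fun i => sval (k i)).
  apply: (proj2 (eqs _ _ _ _)); apply: (iso_coproduct (j := j) (G := e')
    (g := fun i => projT1 (cid (fi i)))) hj.
  - move=> i; case: cid => g [gf fg].
    by rewrite (svalP (k i)) -!compA fg comp_idr.
  - by move=> i; case: cid => g [gf fg] /=; exists (f i).
  - by exists e.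
have /hom_shift_coproduct := cX _ _ _ _ hk.
apply: (iso_coproduct (g := fun i => fmap (hom_from (shift X)) (f i))
  (G := fmap (hom_from (shift X)) e)).
- by move=> i; rewrite -!fmap_comp c.
- by move=> i; apply: fmap_iso.
- exact: fmap_iso.
Qed.

Lemma compact_zero Z : is_zero_object Z -> compact Z.
Proof.
move=> hZ I Y P j _; apply: coproduct_intro => [x|s a _ _ i].
  exists [::], (fun=> 0); split; first by split.
  by rewrite /combination big_nil; apply: (proj2 (hZ P)).
exact: (proj2 (hZ (Y i))).
Qed.

Lemma compact_cone X Y Z (u : hom X Y) (v : hom Y Z) (w : hom Z (shift X)) :
  exact_triangle u v w -> compact X -> compact Y -> compact Z.
Proof.
move=> t cX cY I V P j hj.
have t1 := t; move/tr2 in t1; have t2 := t1; move/tr2 in t2.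
have E X' Y' Z' (u' : hom X' Y') (v' : hom Y' Z') w' W : exact_triangle u' v' w' ->
    exact_at (precomp v' : {additive pre_hom Z' W -> pre_hom Y' W})
             (precomp u' : {additive pre_hom Y' W -> pre_hom X' W}).
  move=> t' y; split=> [y0|[x <-]]; first by have [x <-] := triangle_extend t' y0; exists x.
  by rewrite /= /precomp -compA (triangle_comp0 t') comp0r.
apply: (five_coproduct
  (d1 := fun i => precomp (- fmap shift u)) (D1 := precomp (- fmap shift u))
  (d2 := fun i => precomp w) (D2 := precomp w)
  (d3 := fun i => precomp v) (D3 := precomp v)
  (d4 := fun i => precomp u) (D4 := precomp u)
  (j1 := fun i => postcomp (j i)) (j2 := fun i => postcomp (j i))
  (j4 := fun i => postcomp (j i)) (j5 := fun i => postcomp (j i))).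
- by move=> i x; apply/esym/(@compA T).
- by move=> i x; apply/esym/(@compA T).
- by move=> i x; apply/esym/(@compA T).
- by move=> i x; apply/esym/(@compA T).
- by move=> i; apply: E t2.
- by move=> i; apply: E t1.
- by move=> i; apply: E t.
- exact: E t2.
- exact: E t1.
- exact: E t.
- by have /compact_shift := cY; apply.
- by have /compact_shift := cX; apply.
- exact: cY.
- exact: cX.
Qed.

Lemma compact_triangulated : triangulated_subcategory (@compact T).
Proof.
split.
- exact: compact_zero.
- exact: compact_shift.
- exact: compact_cone.
- move=> X Y Z u v w /tr2/tr2 t cX cZ; apply/compact_shift.
  exact: (compact_cone t cZ (proj1 (compact_shift X) cX)).
- move=> X Y Z u v w /tr2 t cY cZ; apply/compact_shift.
  exact: (compact_cone t).
Qed.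

End Compact.

Definition compacts (T : triangulated_category) : triangulated_category :=
  full_triangulated (compact_triangulated T).

Definition localising (T : triangulated_category) (S : T -> Prop) : Prop :=
  triangulated_subcategory S /\
  forall (I : small_set) (X : I -> T) (P : T) (inj : forall i, hom (X i) P),
    is_coproduct inj -> (forall i, S (X i)) -> S P.

Definition compactly_generated (T : triangulated_category) : Prop :=
  [/\ has_coproducts T, essentially_small (compacts T)
    & forall S : T -> Prop, localising S -> (forall X, compact X -> S X) ->
      forall X, S X].

(* The functor X |-> h_X = Hom(-, X) restricted to the compact objects. *)
Definition restricted_yoneda (T : triangulated_category) : functor T (Coh (compacts T)) :=
  restriction (full_inclusion (compact_triangulated T)).

(* Exactness of 0 -> h_X -> h_Y -> h_Z -> 0 is evaluated at each compact object. *)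
Definition pure_exact (T : triangulated_category) (X Y Z : T)
    (u : hom X Y) (v : hom Y Z) : Prop :=
  forall C : compacts T,
    short_exact (fmap (restricted_yoneda T) u C) (fmap (restricted_yoneda T) v C).

Definition pure_injective (T : triangulated_category) (X : T) : Prop :=
  forall (Y Z : T) (u : hom X Y) (v : hom Y Z) (w : hom Z (shift X)),
    exact_triangle u v w -> pure_exact u v -> split_mono u.

(* Main.v *)
From mathcomp Require Import all_boot all_order all_algebra.
From mathcomp.classical Require Import boolp.
Require Import Defs.

(** Call a morphism phantom if it vanishes on every morphism out of a compact
    object, that is, if restricted Yoneda kills it.

    A phantom f : X -> Y with Y pure-injective is zero ([phantom_eq0]): the
    triangle Y -> Z -> shift X -> shift Y on the cone of f is pure-exact, hence
    Y -> Z is a split monomorphism, and it annihilates f.  This is faithfulness.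

    For fullness, take p : P -> X with P the coproduct of one compact object for
    each morphism to X from a representative of the compact objects
    ([compact_cover]).  A natural transformation phi : h_X -> h_Y prescribes the
    components of a morphism g : P -> Y, and g realises phi after p: because a
    compact object maps to P through finitely many summands, g y = phi (p y) for
    every y : C -> P with C compact.  If k : K -> P is the fibre of p, then g k
    is phantom, so it is zero, and g factors as f p.  Since p is surjective on
    morphisms from compact objects, f realises phi ([natural_realised]).

    Both arguments take place in the ambient category.  As the subcategory is full
    and contains the compact objects, it has the same morphisms and the same
    functors h_X, and the conclusion holds for it too. *)

Set Implicit Arguments.
Unset Strict Implicit.
Unset Printing Implicit Defensive.

Import GRing.Theory.
Local Open Scope ring_scope.
Local Open Scope cat_scope.

Section Phantom.
Variable T : triangulated_category.
Implicit Types X Y Z C : T.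

Definition phantom X Y (f : hom X Y) : Prop :=
  forall C, compact C -> forall c : hom C X, f ∘ c = 0.

(** Holds because every compact object is, up to isomorphism, the shift of a compact
    object. *)
Lemma phantom_shift X Y (f : hom X Y) : phantom f -> phantom (fmap shift f).
Proof.
move=> pf C cC c; have [[fu _] es] := shift_equivalence T.
have [C' [e [e' [e'e ee']]]] := es C.
have cC' : compact C'.
  apply/compact_shift/(sub_iso (compact_triangulated T) (f := e')) => //.
  by exists e.
have [c' c'E] := fu _ _ (c ∘ e).
rewrite -(comp_idr c) -ee' (compA c) -c'E compA -fmap_comp pf //.
by rewrite (additive0 (@shift_additive T)) comp0l.
Qed.

(** In the long exact sequence of Hom(C, -), for C compact, the maps induced by f
    and by its shift vanish, which leaves a short exact sequence. *)
Lemma phantom_pure_exact X Y Z (f : hom X Y) (u : hom Y Z) (v : hom Z (shift X)) :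
  exact_triangle f u v -> phantom f -> pure_exact u v.
Proof.
move=> t pf [C cC]; have t1 := t; move/tr2 in t1; have t2 := t1; move/tr2 in t2.
split.
- apply: raddf_inj => a ua; have [b <-] := triangle_lift t ua.
  exact: pf.
- move=> y; split=> [vy|[x <-]].
    by have [x <-] := triangle_lift t1 vy; exists x.
  by rewrite /= /postcomp compA (triangle_comp0 t1) comp0l.
- move=> z; have [|y <-] := triangle_lift t2 (f := z); last by exists y.
  by rewrite compNl phantom_shift ?oppr0.
Qed.

Lemma phantom_eq0 X Y (f : hom X Y) : pure_injective Y -> phantom f -> f = 0.
Proof.
move=> piY pf; have [Z [u [v t]]] := tr1_cone f.
have t1 := t; move/tr2 in t1.
have [r ru] := piY _ _ _ _ _ t1 (phantom_pure_exact t pf).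
by rewrite -(comp_idl f) -ru -compA (triangle_comp0 t) comp0r.
Qed.

(** The family is indexed by pairs of a representative of the compact objects and
    a morphism from it to X, so it is small. *)
Lemma compact_cover : compactly_generated T -> forall X,
  exists (I : small_set) (C : I -> compacts T) (x : forall i, hom (sval (C i)) X)
    (P : T) (j : forall i, hom (sval (C i)) P) (p : hom P X),
    [/\ is_coproduct j, forall i, p ∘ j i = x i
      & forall B, compact B -> forall b : hom B X, exists y : hom B P, p ∘ y = b].
Proof.
move=> [cop [I0 [c cE]] _] X.
pose I : small_set := {i : I0 & pre_hom (sval (c i)) X}.
have [P [j hj]] := cop I (fun i => sval (c (projT1 i))).
have [p [pE _]] := hj X (fun i => projT2 i).
exists I, (fun i => c (projT1 i)), (fun i => projT2 i), P, j, p; split=> //.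
move=> B cB b.
have [i [e [e' [_ ee']]]] := cE (exist _ B cB : compacts T).
have {}ee' : (e : @hom T _ B) ∘ (e' : @hom T B _) = idm B := ee'.
exists (j (existT _ i (b ∘ (e : @hom T _ B))) ∘ (e' : @hom T B _)).
by rewrite compA pE -compA ee' comp_idr.
Qed.

(** The axioms provide cones only; a fibre is a desuspension of the cone. *)
Lemma triangle_fibre X Y (p : hom X Y) :
  exists K (k : hom K X) (w : hom Y (shift K)), exact_triangle k p w.
Proof.
have [Z [a [b t]]] := tr1_cone p; have [[fu _] es] := shift_equivalence T.
have [K [e [e' [e'e ee']]]] := es Z.
have [k kE] := fu _ _ (- (b ∘ e)).
exists K, k, (e' ∘ a); apply/tr2; rewrite kE opprK.
apply: (tr1_iso (iso_id X) (iso_id Y) _ _ _ _ t (h := e')).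
- by exists e.
- by rewrite comp_idl comp_idr.
- by rewrite comp_idr.
- by rewrite -compA ee' comp_idr fmap_id comp_idl.
Qed.

(** The transformation is given by its components rather than as a morphism of
    cohomological functors, so that the lemma applies to the restriction functor of
    any full subcategory: the components have the same types there, whereas the
    functors have different proof components. *)
Lemma natural_realised X Y
    (phi : forall C : compacts T, {additive pre_hom (sval C) X -> pre_hom (sval C) Y}) :
  compactly_generated T -> pure_injective Y ->
  (forall (B C : compacts T) (b : hom (sval B) (sval C)) (x : hom (sval C) X),
    phi B (x ∘ b) = (phi C x : hom _ Y) ∘ b) ->
  exists f : hom X Y, forall (C : compacts T) (x : hom (sval C) X), f ∘ x = phi C x.
Proof.
move=> cg piY phiN.
have [I [C [x [P [j [p [hj pj psurj]]]]]]] := compact_cover cg X.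
have [g [gj _]] := hj Y (fun i => phi (C i) (x i)).
(* Since B is compact, y is a finite sum of morphisms through the summands of P. *)
have gphi (B : compacts T) (y : hom (sval B) P) : g ∘ y = phi B (p ∘ y).
  have [s [a [_ ->]]] := coproduct_generating (svalP B I _ P j hj) y.
  rewrite /combination.
  rewrite -[LHS]/(postcomp g _) -[X in phi B X]/(postcomp p _) !raddf_sum /=.
  apply: eq_bigr => i _.
  by rewrite /postcomp !compA gj pj phiN.
have [K [k [w t]]] := triangle_fibre p.
have gk0 : g ∘ k = 0.
  apply: phantom_eq0 => // B cB z.
  rewrite -compA (gphi (exist _ B cB : compacts T)) compA (triangle_comp0 t).
  by rewrite comp0l raddf0.
have [f fp] := triangle_extend t gk0.
exists f => B b; have [y <-] := psurj _ (svalP B) b.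
by rewrite compA fp gphi.
Qed.

End Phantom.

Theorem corollary5p4 (T : triangulated_category) (hT : compactly_generated T)
    (D : T -> Prop) (hD : triangulated_subcategory D)
    (hcD : forall X : T, compact X -> D X)
    (hpi : forall X : T, D X -> pure_injective X) :
  is_partial_completion (inclusion (compact_triangulated T) hD hcD).
Proof.
split; first by case: hT.
  by split=> [X Y g|X Y f g //]; exists g.
split=> [[X dX] [Y dY] phi|[X dX] [Y dY] f g fg].
  have [|f fE] := natural_realised (X := X) (Y := Y)
    (phi := fun C => nt phi C) hT (hpi _ dY).
    move=> B C b x; have := nt_natural phi (b : @hom (op (compacts T)) C B).
    exact: (congr1 (fun h : {additive _ -> _} => h x)).
  exists f; apply: nat_trans_ext => C; apply: additive_ext => x.
  exact: fE.
apply/subr0_eq/(phantom_eq0 (hpi _ dY)) => C cC c.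
apply/eqP; rewrite [_ ∘ c](@compBl T) subr_eq0; apply/eqP.
pose C' : compacts T := exist _ C cC.
pose h_ := restriction_obj (inclusion (compact_triangulated T) hD hcD).
have := congr1 (fun s : nat_trans (h_ (exist _ X dX)) (h_ (exist _ Y dY)) => s C') fg.
exact: (congr1 (fun h : {additive _ -> _} => h c)).
Qed.
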